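(* Let $M\in\mathrm{rep}\,G_{m,n}$ be interval-decomposable and $\ast\in\{ss,cc,tot\}$. Then $\tilde M^\ast=[M]$ in the split Grothendieck group $\mathrm{Gr}(\mathrm{rep}\,G_{m,n})$; equivalently $\tilde M^\ast_+\cong M$ and $\tilde M^\ast_-=0$. (Conversely, if $\tilde M^\ast=[M]$ then $M$ is interval-decomposable.)
   Context: Fix a field $K$. For integers $m,n\ge1$, $G_{m,n}$ is the equioriented commutative $m\times n$ grid: the quiver with vertex set $\{(i,j):1\le i\le m,\ 1\le j\le n\}$ and arrows $(i,j)\to(i,j+1)$ and $(i,j)\to(i+1,j)$, bound by all commutativity relations; $\mathrm{rep}\,G_{m,n}$ is its category of finite-dimensional representations over $K$ satisfying the relations. An interval of $G_{m,n}$ is a nonempty full subquiver $I$ which is connected (as an undirected graph) and convex (whenever $x,y\in I_0$ and there are paths $x\to z$, $z\to y$ in $G_{m,n}$, then $z\in I_0$); $\mathbb{I}_{m,n}$ is the set of intervals ordered by inclusion of vertex sets. The interval representation $V_I$ has $K$ at vertices of $I$, $0$ elsewhere, identity maps on arrows inside $I$ and zero maps otherwise; $M$ is interval-decomposable if it is isomorphic to a direct sum of interval representations. Essential vertices: $I^{ss}_0$ is the set of sources and sinks of the quiver $I$; $I^{cc}_0=I_0\cap(\mathrm{pr}_1(I^{ss}_0)\times\mathrm{pr}_2(I^{ss}_0))$ with $\mathrm{pr}_1,\mathrm{pr}_2$ coordinate projections; $I^{tot}_0=I_0$. Let $KG_{m,n}$ be the $K$-linear category whose objects are the vertices and whose morphisms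 are $K$-linear combinations of paths modulo the commutativity relations; representations are $K$-linear functors $KG_{m,n}\to\mathrm{vect}_K$. For $\ast\in\{ss,cc,tot\}$, $\mathcal{C}^\ast_I$ is the full subcategory of $KG_{m,n}$ on $I^\ast_0$, and $M^\ast_I:=M|_{\mathcal{C}^\ast_I}$. The compressed multiplicity $\bar d^\ast_M(I)$ is the multiplicity of the indecomposable $(V_I)^\ast_I$ as a direct summand of $M^\ast_I$. Let $\mu$ be the Möbius function of the finite poset $\mathbb{I}_{m,n}$, and $\tilde d^\ast_M(I):=\sum_{J\ge I}\mu([I,J])\,\bar d^\ast_M(J)$. The split Grothendieck group $\mathrm{Gr}(\mathrm{rep}\,G_{m,n})$ is the free abelian group on isomorphism classes $[X]$ modulo $[X_1\oplus X_2]=[X_1]+[X_2]$; it has basis the classes of indecomposables. The interval-decomposable approximation is $\tilde M^\ast:=\sum_{I\in\mathbb{I}_{m,n}}\tilde d^\ast_M(I)[V_I]$, with positive part $\tilde M^\ast_+=\bigoplus_{\tilde d^\ast_M(I)>0}V_I^{\tilde d^\ast_M(I)}$ and negative part $\tilde M^\ast_-=\bigoplus_{\tilde d^\ast_M(I)<0}V_I^{-\tilde d^\ast_M(I)}$, so $\tilde M^\ast=[\tilde M^\ast_+]-[\tilde M^\ast_-]$. *)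

(* Defs.v *)
From HB Require Import structures.
From mathcomp Require Import all_boot all_order all_algebra.
Set Implicit Arguments. Unset Strict Implicit. Unset Printing Implicit Defensive.
Import Order.TTheory GRing.Theory Num.Theory.
Local Open Scope ring_scope.

(* Vertices of the grid G_{m,n}: (i,j) with 0 <= i < m, 0 <= j < n
   (0-based version of 1 <= i <= m, 1 <= j <= n). *)
Definition vert (m n : nat) := ('I_m * 'I_n)%type.

(* x <= y iff there is a path x -> y in G_{m,n}. *)
Definition vle m n (x y : vert m n) : bool :=
  ((x.1 <= y.1)%N && (x.2 <= y.2)%N).

Definition arrow m n (x y : vert m n) : bool :=
  ((nat_of_ord x.1 == nat_of_ord y.1) && (nat_of_ord y.2 == (nat_of_ord x.2).+1))
  || ((nat_of_ord x.2 == nat_of_ord y.2) && (nat_of_ord y.1 == (nat_of_ord x.1).+1)).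

Definition adj m n (x y : vert m n) : bool := arrow x y || arrow y x.

(* Intervals: nonempty, connected (as undirected graph of the full subquiver),
   convex.  A full subquiver is determined by its vertex set. *)
Definition is_interval m n (I : {set vert m n}) : bool :=
  [&& I != set0,
      [forall x in I, forall y in I,
         connect [rel a b | [&& a \in I, b \in I & adj a b]] x y] &
      [forall x in I, forall y in I, forall z,
         (vle x z && vle z y) ==> (z \in I)]].

Definition intervals m n : {set {set vert m n}} := [set I | is_interval I].

(* A (raw) K-linear functor on (a full subcategory of) KG_{m,n}: a vector space
   K^(rdim x) at each vertex and, for each pair x <= y, the image
   rmor x y of the (unique up to scalar) morphism x -> y of KG_{m,n}.
   Matrices act on row vectors (v |-> v *m A). *)
Record rawrep (K : fieldType) (m n : nat) := RawRep {
  rdim : vert m n -> nat ;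
  rmor : forall x y : vert m n, 'M[K]_(rdim x, rdim y) }.

Definition is_rep (K : fieldType) m n (S : {set vert m n}) (M : rawrep K m n) : Prop :=
  (forall x, x \in S -> rmor M x x = 1%:M) /\
  (forall x y z, x \in S -> y \in S -> z \in S -> vle x y -> vle y z ->
     rmor M x z = rmor M x y *m rmor M y z).

Definition is_hom (K : fieldType) m n (S : {set vert m n}) (M N : rawrep K m n)
  (f : forall x, 'M[K]_(rdim M x, rdim N x)) : Prop :=
  forall x y, x \in S -> y \in S -> vle x y ->
    rmor M x y *m f y = f x *m rmor N x y.

Definition rep_iso (K : fieldType) m n (S : {set vert m n}) (M N : rawrep K m n) : Prop :=
  exists (f : forall x, 'M[K]_(rdim M x, rdim N x))
         (g : forall x, 'M[K]_(rdim N x, rdim M x)),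
    [/\ is_hom S f, is_hom S g &
        forall x, x \in S -> f x *m g x = 1%:M /\ g x *m f x = 1%:M].

Definition dsum (K : fieldType) m n (M N : rawrep K m n) : rawrep K m n :=
  @RawRep K m n (fun x => (rdim M x + rdim N x)%N)
    (fun x y => block_mx (rmor M x y) 0 0 (rmor N x y)).

Definition zrep (K : fieldType) m n : rawrep K m n :=
  @RawRep K m n (fun _ => 0%N) (fun x y => 0).

Fixpoint npow (K : fieldType) m n (N : rawrep K m n) (k : nat) : rawrep K m n :=
  match k with
  | 0 => zrep K m n
  | k'.+1 => dsum N (npow N k')
  end.

Definition bigdsum (K : fieldType) m n (A : Type) (s : seq A) (F : A -> rawrep K m n)
  : rawrep K m n := foldr (fun a acc => dsum (F a) acc) (zrep K m n) s.

(* interval representation V_I, as a functor: K on I, identities between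
   comparable vertices of I, zero otherwise (const_mx 1 is the 1x1 identity
   when both ends are in I, and an empty matrix otherwise). *)
Definition Vrep (K : fieldType) m n (I : {set vert m n}) : rawrep K m n :=
  @RawRep K m n (fun x => nat_of_bool (x \in I)) (fun x y => const_mx 1).

Definition int_dec (K : fieldType) m n (M : rawrep K m n) : Prop :=
  exists s : seq {set vert m n},
    all (fun I => I \in intervals m n) s /\ rep_iso setT M (bigdsum s (@Vrep K m n)).

Inductive ess := ess_ss | ess_cc | ess_tot.

Definition is_source m n (I : {set vert m n}) (x : vert m n) : bool :=
  [forall a, ~~ ((a \in I) && arrow a x)].
Definition is_sink m n (I : {set vert m n}) (x : vert m n) : bool :=
  [forall b, ~~ ((b \in I) && arrow x b)].

Definition ss_set m n (I : {set vert m n}) : {set vert m n} :=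
  [set x in I | is_source I x || is_sink I x].

Definition cc_set m n (I : {set vert m n}) : {set vert m n} :=
  [set x in I | [exists a in ss_set I, a.1 == x.1] && [exists b in ss_set I, b.2 == x.2]].

Definition essv (e : ess) m n (I : {set vert m n}) : {set vert m n} :=
  match e with ess_ss => ss_set I | ess_cc => cc_set I | ess_tot => I end.

(* k is the multiplicity of N as a direct summand of X over S: the largest k
   such that N^k is a direct summand of X (by Krull-Schmidt this is the
   multiplicity of the indecomposable N in a decomposition of X). *)
Definition is_mult (K : fieldType) m n (S : {set vert m n}) (N X : rawrep K m n) (k : nat)
  : Prop :=
  (exists Y, is_rep S Y /\ rep_iso S X (dsum (npow N k) Y)) /\
  (forall k' Y, is_rep S Y -> rep_iso S X (dsum (npow N k') Y) -> (k' <= k)%N).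

(* Moebius function of the poset of intervals, by its defining recursion
   (mu(I,I)=1, mu(I,J) = - sum_{I <= L < J} mu(I,L) for I < J, 0 otherwise);
   the fuel #|J|.+1 suffices since L < J implies #|L| < #|J|. *)
Fixpoint mobf m n (f : nat) (I J : {set vert m n}) : int :=
  match f with
  | 0 => 0
  | f'.+1 =>
      if I == J then 1
      else if I \proper J then
        - \sum_(L in intervals m n | (I \subset L) && (L \proper J)) mobf f' I L
      else 0
  end.
Definition mobius m n (I J : {set vert m n}) : int := mobf #|J|.+1 I J.

Definition dtilde m n (dbar : {set vert m n} -> nat) (I : {set vert m n}) : int :=
  \sum_(J in intervals m n | I \subset J) mobius I J * (dbar J)%:Z.

Definition posn (z : int) : nat := if (0 < z) then absz z else 0%N.

Definition Mplus (K : fieldType) m n (dbar : {set vert m n} -> nat) : rawrep K m n :=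
  bigdsum (enum (intervals m n)) (fun I => npow (Vrep K I) (posn (dtilde dbar I))).
Definition Mminus (K : fieldType) m n (dbar : {set vert m n} -> nat) : rawrep K m n :=
  bigdsum (enum (intervals m n)) (fun I => npow (Vrep K I) (posn (- dtilde dbar I))).

(* [P] - [Q] = [M] in the split Grothendieck group of rep G_{m,n}:
   P + Z ~ M + Q + Z for some representation Z. *)
Definition gr_eq (K : fieldType) m n (P Q M : rawrep K m n) : Prop :=
  exists Z, is_rep setT Z /\ rep_iso setT (dsum P Z) (dsum (dsum M Q) Z).

(* Main.v *)
Require Import Defs.
From mathcomp Require Import all_boot all_order all_algebra.
From mathcomp Require Import zify.
From Stdlib Require Import Classical.
Import Order.TTheory GRing.Theory Num.Theory.
Local Open Scope ring_scope.
Set Implicit Arguments. Unset Strict Implicit. Unset Printing Implicit Defensive.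

(* The multiplicity of V_J in a sum of V_L over the essential vertices S of J is
   the number of summands with J <= L: every morphism V_J -> V_L -> V_J over S
   is a scalar, because S contains the sources and sinks of J and is therefore
   connected under <=, and this scalar vanishes when some vertex of S lies
   outside L.  Moebius inversion recovers the number of summands equal to J.
   For the converse, the rank of the composition pairing
   Hom(V_J, X) x Hom(X, V_J) -> End(V_J) = K is additive in X and counts the
   V_J-summands of X, which replaces the Krull-Schmidt theorem. *)

(** * Isomorphisms, direct sums and split summands over a set of vertices *)

Section DirectSums.
Context {K : fieldType} {m n : nat}.
Implicit Types (S : {set vert m n}) (A B C D X N : rawrep K m n).

Lemma rep_iso_refl S A : rep_iso S A A.
Proof.
exists (fun x => 1%:M), (fun x => 1%:M).
by split=> [x y _ _ _|x y _ _ _|x _]; rewrite !mulmx1 ?mul1mx.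
Qed.

Lemma rep_iso_sym S A B : rep_iso S A B -> rep_iso S B A.
Proof. by move=> [f [g [hf hg fg]]]; exists g, f; split=> // x /fg []. Qed.

Lemma rep_iso_trans S B A C : rep_iso S A B -> rep_iso S B C -> rep_iso S A C.
Proof.
move=> [f [g [hf hg fg]]] [f' [g' [hf' hg' fg']]].
exists (fun x => f x *m f' x), (fun x => g' x *m g x).
split=> [x y Sx Sy xy|x y Sx Sy xy|x Sx].
- by rewrite mulmxA hf // -!mulmxA hf'.
- by rewrite mulmxA hg' // -!mulmxA hg.
- have [fg1 gf1] := fg x Sx; have [fg1' gf1'] := fg' x Sx; split.
    by rewrite mulmxA -(mulmxA _ (f' x)) fg1' mulmx1.
  by rewrite mulmxA -(mulmxA _ (g x)) gf1 mulmx1.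
Qed.

Lemma rep_iso_sub S' S A B : S \subset S' -> rep_iso S' A B -> rep_iso S A B.
Proof.
move=> /subsetP sub [f [g [hf hg fg]]]; exists f, g.
by split=> [x y /sub Sx /sub Sy|x y /sub Sx /sub Sy|x /sub]; [exact: hf|exact: hg|exact: fg].
Qed.

Lemma rep_iso_rdim S A B x : rep_iso S A B -> x \in S -> rdim A x = rdim B x.
Proof.
move=> [f [g [_ _ fg]]] /fg[fg1 gf1]; apply/eqP.
by rewrite eqn_leq (mulmx1_min fg1) (mulmx1_min gf1).
Qed.

Lemma rep_iso_dsum S A B C D :
  rep_iso S A B -> rep_iso S C D -> rep_iso S (dsum A C) (dsum B D).
Proof.
move=> [f [g [hf hg fg]]] [f' [g' [hf' hg' fg']]].
exists (fun x => block_mx (f x) 0 0 (f' x)), (fun x => block_mx (g x) 0 0 (g' x)).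
split=> [x y Sx Sy xy|x y Sx Sy xy|x Sx] /=;
  rewrite !mulmx_block !(mulmx0, mul0mx, addr0, add0r).
- by rewrite hf // hf'.
- by rewrite hg // hg'.
- have [fg1 gf1] := fg x Sx; have [fg1' gf1'] := fg' x Sx.
  by rewrite fg1 fg1' gf1 gf1' -!scalar_mx_block.
Qed.

Lemma dsumC_iso S A B : rep_iso S (dsum A B) (dsum B A).
Proof.
exists (fun x => block_mx 0 1%:M 1%:M 0), (fun x => block_mx 0 1%:M 1%:M 0).
split=> [x y _ _ _|x y _ _ _|x _] /=;
  rewrite !mulmx_block !(mulmx0, mul0mx, mulmx1, mul1mx, addr0, add0r) //.
by rewrite -!scalar_mx_block.
Qed.

Lemma dsumA_iso S A B C : rep_iso S (dsum (dsum A B) C) (dsum A (dsum B C)).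
Proof.
exists (fun x => col_mx (col_mx (row_mx 1%:M (row_mx 0 0)) (row_mx 0 (row_mx 1%:M 0)))
                        (row_mx 0 (row_mx 0 1%:M))).
exists (fun x => col_mx (row_mx (row_mx 1%:M 0) 0)
                  (col_mx (row_mx (row_mx 0 1%:M) 0) (row_mx (row_mx 0 0) 1%:M))).
have E := (mul_col_mx, mul_mx_row, mul_row_col, mul_row_block, mulmx0, mul0mx,
           mulmx1, mul1mx, addr0, add0r, row_mx0).
split=> [x y _ _ _|x y _ _ _|x _] /=.
- by rewrite /block_mx !E.
- by rewrite /block_mx !E.
- split; rewrite !E !scalar_mx_block.
  + by rewrite -[X in col_mx X _ = _]block_mxEv block_mxEh col_mx0.
  + by rewrite -[X in col_mx _ X = _]block_mxEv block_mxEh col_mx0.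
Qed.

Lemma dsum0_iso S A B : (forall x, x \in S -> rdim B x = 0%N) -> rep_iso S (dsum A B) A.
Proof.
move=> B0; exists (fun x => col_mx 1%:M 0), (fun x => row_mx 1%:M 0).
have Bz p x (u : 'M[K]_(rdim B x, p)) : x \in S -> u = 0.
  by move/B0 => e; move: u; rewrite e => u; rewrite flatmx0.
split=> [x y Sx Sy _|x y Sx Sy _|x Sx] /=.
- by rewrite mul_block_col mul_col_mx !mulmx1 !mul1mx !mulmx0 !mul0mx !addr0.
- by rewrite mul_row_block mul_mx_row !mulmx1 !mul1mx !mulmx0 !mul0mx !addr0.
- rewrite mul_row_col mul0mx addr0 mulmx1 mul_col_row !mulmx1 mulmx0 !mul0mx scalar_mx_block.
  by split=> //; congr block_mx; rewrite [RHS](Bz _ _ _ Sx).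
Qed.

Lemma is_rep_dsum S A B : is_rep S A -> is_rep S B -> is_rep S (dsum A B).
Proof.
move=> [A1 A2] [B1 B2]; split=> [x Sx|x y z Sx Sy Sz xy yz] /=.
  by rewrite A1 // B1 // -scalar_mx_block.
by rewrite mulmx_block !(mulmx0, mul0mx, addr0, add0r) -A2 // -B2.
Qed.

Lemma is_rep_zrep S : is_rep S (zrep K m n).
Proof. by split=> *; rewrite /= ?mul0mx // flatmx0. Qed.

(** The idempotents [E x = 1 - g x *m f x] commute with the structure maps of [X], and the
    complement of [N] is their image. A full-rank factorization of each [E x] gives matrices for the
    inclusion and the projection of that image. *)
Lemma rep_split S X N
    (f : forall x, 'M_(rdim N x, rdim X x)) (g : forall x, 'M_(rdim X x, rdim N x)) :
  is_rep S X -> is_hom S f -> is_hom S g -> (forall x, x \in S -> f x *m g x = 1%:M) ->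
  exists2 Y, is_rep S Y & rep_iso S X (dsum N Y).
Proof.
move=> [X1 X2] hf hg fg.
pose E x := 1%:M - g x *m f x; pose i x := row_base (E x); pose p x := col_base (E x).
have pi x : p x *m i x = E x by exact: mulmx_base.
have fE x : x \in S -> f x *m E x = 0.
  by move=> Sx; rewrite mulmxBr mulmx1 mulmxA fg // mul1mx subrr.
have Eg x : x \in S -> E x *m g x = 0.
  by move=> Sx; rewrite mulmxBl mul1mx -mulmxA fg // mulmx1 subrr.
have EE x : x \in S -> E x *m E x = E x.
  by move=> Sx; rewrite {1}/E mulmxBl mul1mx -mulmxA fE // mulmx0 subr0.
(* Idempotency reads [p i p i = p i]; cancelling the full column base on the left and the free row
   base on the right leaves [i p = 1]. *)
have ip x : x \in S -> i x *m p x = 1%:M.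
  move=> Sx; apply: (row_free_inj (row_base_free (E x))).
  apply: (row_full_inj (col_base_full (E x))).
  by rewrite /= -/(i x) -/(p x) mul1mx -[i x *m p x *m i x]mulmxA pi [LHS]mulmxA pi EE.
(* From here on only [p i = E] and [i p = 1] are used. *)
clearbody i p.
have fp x : x \in S -> f x *m p x = 0.
  by move=> Sx; rewrite -[LHS]mulmx1 -(ip x Sx) !mulmxA -(mulmxA (f x)) pi fE // mul0mx.
have ig x : x \in S -> i x *m g x = 0.
  by move=> Sx; rewrite -[LHS]mul1mx -(ip x Sx) -mulmxA (mulmxA (p x)) pi Eg // mulmx0.
have XE x y : x \in S -> y \in S -> vle x y -> rmor X x y *m E y = E x *m rmor X x y.
  move=> Sx Sy xy; rewrite mulmxBr mulmx1 mulmxBl mul1mx mulmxA hg //.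
  by rewrite -mulmxA hf // mulmxA.
have iE x : x \in S -> i x *m E x = i x.
  by move=> Sx; rewrite -[RHS]mul1mx -(ip x Sx) -mulmxA pi.
have Ep x : x \in S -> E x *m p x = p x.
  by move=> Sx; rewrite -[RHS]mulmx1 -(ip x Sx) mulmxA pi.
exists (@RawRep K m n (fun x => \rank (E x)) (fun x y => i x *m rmor X x y *m p y)).
  split=> [x Sx|x y z Sx Sy Sz xy yz] /=; first by rewrite X1 // mulmx1 ip.
  rewrite (X2 x y z) // !mulmxA -(mulmxA _ (p y)) pi.
  by rewrite -(mulmxA (i x) _ (E y)) XE // mulmxA iE.
exists (fun x => row_mx (g x) (p x)), (fun x => col_mx (f x) (i x)).
split=> [x y Sx Sy xy|x y Sx Sy xy|x Sx] /=.
- rewrite mul_mx_row mul_row_block !mulmx0 addr0 add0r hg //; congr row_mx.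
  by rewrite !mulmxA pi -XE // -mulmxA Ep.
- rewrite mul_block_col mul_col_mx !mul0mx addr0 add0r hf //; congr col_mx.
  by rewrite -mulmxA pi -!mulmxA XE // !mulmxA iE.
- split; first by rewrite mul_row_col pi /E addrC subrK.
  by rewrite mul_col_row fg // ip // fp // ig // -scalar_mx_block.
Qed.

Lemma bigdsum_cat_iso S (T : Type) (F : T -> rawrep K m n) (s t : seq T) :
  rep_iso S (bigdsum (s ++ t) F) (dsum (bigdsum s F) (bigdsum t F)).
Proof.
elim: s => [|a s IHs] /=.
  by apply: rep_iso_sym; apply: rep_iso_trans (dsumC_iso _ _ _) _; apply: dsum0_iso.
apply: rep_iso_trans (rep_iso_dsum (rep_iso_refl _ _) IHs) _.
exact: rep_iso_sym (dsumA_iso _ _ _ _).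
Qed.

Lemma bigdsum_perm_iso S (T : eqType) (F : T -> rawrep K m n) (s t : seq T) :
  perm_eq s t -> rep_iso S (bigdsum s F) (bigdsum t F).
Proof.
elim: s t => [|a s IHs] t; first by rewrite perm_sym => /perm_nilP->; exact: rep_iso_refl.
move=> pst; have at_ : a \in t by rewrite -(perm_mem pst) mem_head.
case/path.splitPr: at_ pst => t1 t2 pst.
have {}pst : perm_eq s (t1 ++ t2).
  by rewrite -(perm_cons a); apply: perm_trans pst _; rewrite perm_catC /= perm_cons perm_catC.
apply: rep_iso_trans (rep_iso_dsum (rep_iso_refl _ _) (IHs _ pst)) _.
apply: rep_iso_trans (rep_iso_dsum (rep_iso_refl _ _) (bigdsum_cat_iso _ _ _ _)) _.
apply: rep_iso_trans; last exact: rep_iso_sym (bigdsum_cat_iso _ _ _ _).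
apply: rep_iso_trans; last exact: dsumC_iso.
apply: rep_iso_trans; last exact: rep_iso_sym (dsumA_iso _ _ _ _).
exact: rep_iso_dsum (rep_iso_refl _ _) (dsumC_iso _ _ _).
Qed.

Lemma bigdsum_npow_iso S (T : eqType) (F : T -> rawrep K m n) (c : T -> nat) (s : seq T) :
  rep_iso S (bigdsum s (fun a => npow (F a) (c a)))
            (bigdsum (flatten [seq nseq (c a) a | a <- s]) F).
Proof.
elim: s => [|a s IHs] /=; first exact: rep_iso_refl.
apply: rep_iso_trans; last exact: rep_iso_sym (bigdsum_cat_iso _ _ _ _).
apply: rep_iso_dsum => //.
have -> : npow (F a) (c a) = bigdsum (nseq (c a) a) F by elim: (c a) => //= k ->.
exact: rep_iso_refl.
Qed.

Lemma rdim_bigdsum (T : Type) (F : T -> rawrep K m n) (s : seq T) x :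
  rdim (bigdsum s F) x = (\sum_(a <- s) rdim (F a) x)%N.
Proof. by elim: s => [|a s IHs] /=; rewrite ?big_nil ?big_cons ?IHs. Qed.

Lemma rdim_npow N k x : rdim (npow N k) x = (k * rdim N x)%N.
Proof. by elim: k => //= k ->; rewrite mulSn. Qed.

End DirectSums.

(** * Order geometry of intervals and their essential vertices *)

Section Intervals.
Context {m n : nat}.
Implicit Types (x y z : vert m n) (I J L S : {set vert m n}).

Lemma vle_refl x : vle x x.
Proof. by rewrite /vle !leqnn. Qed.

Lemma vle_trans y x z : vle x y -> vle y z -> vle x z.
Proof.
by move=> /andP[a b] /andP[c d]; apply/andP; split; [exact: leq_trans c|exact: leq_trans d].
Qed.

Lemma arrow_vle x y : arrow x y -> vle x y.
Proof. by case/orP=> /andP[/eqP e1 /eqP e2]; rewrite /vle e1 e2 leqnn leqnSn. Qed.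

(** Walking backwards along arrows inside [J] lowers the sum of the coordinates, so the walk ends,
    and it can end only at a source. *)
Lemma source_below J x : x \in J -> exists2 s, s \in ss_set J & vle s x.
Proof.
have [k] := ubnP (x.1 + x.2); elim: k x => // k IHk x lt_x Jx.
have [sx|] := boolP (is_source J x); first by exists x; rewrite ?vle_refl // inE Jx sx.
rewrite negb_forall => /existsP[a]; rewrite negbK => /andP[Ja ax].
have [|s ss_s sa] := IHk a _ Ja; last by exists s; last exact: vle_trans sa (arrow_vle ax).
by case/orP: ax => /andP[/eqP e1 /eqP e2]; move: lt_x; rewrite e1 e2; lia.
Qed.

Lemma sink_above J x : x \in J -> exists2 t, t \in ss_set J & vle x t.
Proof.
have [k] := ubnP ((m - x.1) + (n - x.2)); elim: k x => // k IHk x lt_x Jx.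
have [sx|] := boolP (is_sink J x); first by exists x; rewrite ?vle_refl // inE Jx sx orbT.
rewrite negb_forall => /existsP[a]; rewrite negbK => /andP[Ja xa].
have [|s ss_s sa] := IHk a _ Ja; last by exists s; last exact: vle_trans (arrow_vle xa) sa.
have := ltn_ord a.1; have := ltn_ord a.2.
by case/orP: xa => /andP[/eqP e1 /eqP e2]; move: lt_x; rewrite e1 e2; lia.
Qed.

Lemma ss_set_sub J : ss_set J \subset J.
Proof. by apply/subsetP => x; rewrite inE => /andP[]. Qed.

Lemma interval_convex J x y z :
  is_interval J -> x \in J -> y \in J -> vle x z -> vle z y -> z \in J.
Proof.
case/and3P=> _ _ /forall_inP cvx Jx Jy xz zy.
by have /forall_inP/(_ y Jy)/forallP/(_ z)/implyP := cvx x Jx; apply; rewrite xz.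
Qed.

(** This is the connectedness of [S] inside [J] under comparability. A walk in [J] may leave [S], so
    it is replaced by essential vertices lying below its successive vertices; two of these below a
    common vertex are linked through a sink above it. *)
Lemma interval_const (T : Type) (h : vert m n -> T) J S :
  is_interval J -> ss_set J \subset S ->
  (forall x y, x \in S -> x \in J -> y \in S -> y \in J -> vle x y -> h x = h y) ->
  forall x y, x \in S -> x \in J -> y \in S -> y \in J -> h x = h y.
Proof.
case/and3P=> _ /forall_inP con _ /subsetP ssS hc x y Sx Jx Sy Jy.
have Jss s : s \in ss_set J -> s \in J by apply/subsetP/ss_set_sub.
have hss z s s' : z \in J -> s \in ss_set J -> s' \in ss_set J ->
    vle s z -> vle s' z -> h s = h s'.
  move=> Jz ss_s ss_s' sz s'z; have [t ss_t zt] := sink_above Jz.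
  by rewrite (hc s t) ?(hc s' t) ?Jss ?ssS //; apply: vle_trans zt.
have [s ss_s sx] := source_below Jx; have [s' ss_s' s'y] := source_below Jy.
rewrite -(hc s x (ssS _ ss_s) (Jss _ ss_s) Sx Jx sx).
rewrite -(hc s' y (ssS _ ss_s') (Jss _ ss_s') Sy Jy s'y).
have /forall_inP/(_ y Jy)/connectP[p pth] := con x Jx; move: pth.
(* The induction carries an essential vertex [s] below the current vertex [x] instead of the
   membership of [x] in [S]. *)
elim: p x {Sx} Jx s ss_s sx => [|z p IHp] x Jx s ss_s sx /=.
  by move=> _ eyx; apply: (hss x) => //; rewrite -eyx.
case/andP=> /and3P[_ Jz xz] pth last_y.
have [s1 ss_s1 s1z] := source_below Jz.
rewrite -(IHp z Jz s1 ss_s1 s1z pth last_y).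
(* Both [s] and [s1] lie below the head of the arrow joining [x] and [z], whichever its
   direction. *)
case/orP: xz => /arrow_vle xz; [apply: (hss z)|apply: (hss x)] => //.
  exact: vle_trans xz.
exact: vle_trans xz.
Qed.

(** Every vertex of [J] lies between a source and a sink of [J], so convexity of [L] captures it.
    Hence testing containment on essential vertices loses nothing. *)
Lemma ss_set_sub_interval J L : is_interval L -> ss_set J \subset L -> J \subset L.
Proof.
move=> iL /subsetP sub; apply/subsetP => x Jx.
have [s ss_s sx] := source_below Jx; have [t ss_t xt] := sink_above Jx.
exact: (interval_convex iL (sub s ss_s) (sub t ss_t)).
Qed.

Lemma interval_neq0 J : is_interval J -> exists x, x \in J.
Proof. by case/and3P=> /set0Pn. Qed.

Lemma ss_set_essv e J : ss_set J \subset essv e J.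
Proof.
case: e; rewrite /= ?ss_set_sub //; apply/subsetP => x ss_x.
rewrite inE (subsetP (ss_set_sub J)) //=.
by apply/andP; split; apply/exists_inP; exists x.
Qed.

Lemma essv_sub e J : essv e J \subset J.
Proof. by case: e; rewrite //= ?ss_set_sub //; apply/subsetP => x; rewrite inE => /andP[]. Qed.

Lemma essv_sub_interval e J L : is_interval L -> (essv e J \subset L) = (J \subset L).
Proof.
move=> iL; apply/idP/idP => [|JL]; last exact: subset_trans (essv_sub e J) JL.
by move=> eL; apply: ss_set_sub_interval iL (subset_trans (ss_set_essv e J) eL).
Qed.

End Intervals.

(** In the uses below [q] is the dimension, 0 or 1, of an interval representation at the middle
    vertex, so the factor tells whether the composite survives there. *)
Lemma const_mx1_mul (R : pzSemiRingType) p q r :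
  (const_mx 1 : 'M[R]_(p, q)) *m (const_mx 1 : 'M[R]_(q, r)) = q%:R *: const_mx 1.
Proof.
apply/matrixP => i j; rewrite !mxE.
under eq_bigr => k _ do rewrite !mxE mulr1.
by rewrite sumr_const card_ord mulr1.
Qed.

(** * Lower and upper bounds for multiplicities from composites through [X] *)

Section Multiplicity.
Context {K : fieldType} {m n : nat}.
Implicit Types (S J L : {set vert m n}) (X A B : rawrep K m n) (x y : vert m n).

(* A morphism V_J^p -> X and a morphism X -> V_J^p over S; the components of U
   and W outside J are junk and never constrained. *)
Definition hom_pair S J X p
    (U : forall x, 'M[K]_(p, rdim X x)) (W : forall x, 'M[K]_(rdim X x, p)) : Prop :=
  forall x y, x \in S -> y \in S -> vle x y ->
    (x \in J -> U x *m rmor X x y = (y \in J)%:R *: U y) /\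
    (y \in J -> rmor X x y *m W y = (x \in J)%:R *: W x).

(** The composite of V_J^k -> X -> V_J^k is the identity, so k copies of V_J split off. *)
Definition mult_ge S J X k : Prop :=
  exists (U : forall x, 'M[K]_(k, rdim X x)) (W : forall x, 'M[K]_(rdim X x, k)),
    hom_pair S J U W /\ forall x, x \in S -> x \in J -> U x *m W x = 1%:M.

(** Arbitrary composites V_J^p -> X -> V_J^p are tested, not only identities: the two parts of a
    composite through a direct sum are in general not identities, and the bound has to apply to each
    of them. *)
Definition mult_le S J X k : Prop :=
  forall p (U : forall x, 'M[K]_(p, rdim X x)) (W : forall x, 'M[K]_(rdim X x, p)),
    hom_pair S J U W -> forall x, x \in S -> x \in J -> (\rank (U x *m W x) <= k)%N.

Lemma mult_ge_le S J X k k' x :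
  x \in S -> x \in J -> mult_ge S J X k -> mult_le S J X k' -> (k <= k')%N.
Proof.
by move=> Sx Jx [U [W [UW UW1]]] /(_ _ U W UW x Sx Jx); rewrite UW1 // mxrank1.
Qed.

Lemma mult_ge0 S J X : mult_ge S J X 0.
Proof.
exists (fun x => 0), (fun x => 0); split=> [x y _ _ _|x _ _].
  by rewrite mul0mx mulmx0 !scaler0.
by rewrite mul0mx [RHS]flatmx0.
Qed.

Lemma mult_ge_iso S J A B k : rep_iso S A B -> mult_ge S J A k -> mult_ge S J B k.
Proof.
move=> [f [g [hf hg fg]]] [U [W [UW UW1]]].
exists (fun x => U x *m f x), (fun x => g x *m W x); split=> [x y Sx Sy xy|x Sx Jx].
  have [UX XW] := UW x y Sx Sy xy; split=> [Jx|Jy].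
    by rewrite -mulmxA -hf // mulmxA UX // scalemxAl.
  by rewrite mulmxA hg // -mulmxA XW // scalemxAr.
by rewrite mulmxA -(mulmxA (U x)) (fg x Sx).1 mulmx1 UW1.
Qed.

Lemma mult_le_iso S J A B k : rep_iso S A B -> mult_le S J A k -> mult_le S J B k.
Proof.
move=> [f [g [hf hg fg]]] leA p U W UW x Sx Jx.
have UWA : hom_pair S J (fun x => U x *m g x) (fun x => f x *m W x).
  move=> {Sx Jx}x y Sx Sy xy; have [UX XW] := UW x y Sx Sy xy; split=> [Jx|Jy].
    by rewrite -mulmxA -hg // mulmxA UX // scalemxAl.
  by rewrite mulmxA hf // -mulmxA XW // scalemxAr.
have := leA _ _ _ UWA x Sx Jx.
by rewrite mulmxA -(mulmxA (U x)) (fg x Sx).2 mulmx1.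
Qed.

Lemma mult_ge_dsum S J A B k l :
  mult_ge S J A k -> mult_ge S J B l -> mult_ge S J (dsum A B) (k + l).
Proof.
move=> [U [W [UW UW1]]] [U' [W' [UW' UW1']]].
exists (fun x => block_mx (U x) 0 0 (U' x)), (fun x => block_mx (W x) 0 0 (W' x)).
split=> [x y Sx Sy xy|x Sx Jx] /=.
  have [UX XW] := UW x y Sx Sy xy; have [UX' XW'] := UW' x y Sx Sy xy.
  split=> [Jx|Jy]; rewrite mulmx_block !(mulmx0, mul0mx, addr0, add0r);
    by rewrite scale_block_mx !scaler0 ?UX ?UX' ?XW ?XW'.
by rewrite mulmx_block !(mulmx0, mul0mx, addr0, add0r) UW1 // UW1' // -scalar_mx_block.
Qed.

(** A composite through the direct sum is the sum of a composite through [A] and one through [B],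
    and rank is subadditive. *)
Lemma mult_le_dsum S J A B k l :
  mult_le S J A k -> mult_le S J B l -> mult_le S J (dsum A B) (k + l).
Proof.
move=> leA leB p U W UW x Sx Jx.
have E z : U z *m W z = lsubmx (U z) *m usubmx (W z) + rsubmx (U z) *m dsubmx (W z).
  by rewrite -mul_row_col hsubmxK vsubmxK.
rewrite E; apply: leq_trans (mxrank_add _ _) (leq_add _ _).
- apply: (leA p (fun x => lsubmx (U x)) (fun x => usubmx (W x))) => // {}x y {Jx}{}Sx Sy xy.
  have [UX XW] := UW x y Sx Sy xy; split=> [/UX|/XW]/=.
    rewrite -{1}[U x]hsubmxK mul_row_block -[U y in RHS]hsubmxK scale_row_mx !mulmx0 !(addr0, add0r).
    by case/eq_row_mx.
  rewrite -{1}[W y]vsubmxK mul_block_col -[W x in RHS]vsubmxK scale_col_mx !mul0mx !(addr0, add0r).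
  by case/eq_col_mx.
- apply: (leB p (fun x => rsubmx (U x)) (fun x => dsubmx (W x))) => // {}x y {Jx}{}Sx Sy xy.
  have [UX XW] := UW x y Sx Sy xy; split=> [/UX|/XW]/=.
    rewrite -{1}[U x]hsubmxK mul_row_block -[U y in RHS]hsubmxK scale_row_mx !mulmx0 !(addr0, add0r).
    by case/eq_row_mx.
  rewrite -{1}[W y]vsubmxK mul_block_col -[W x in RHS]vsubmxK scale_col_mx !mul0mx !(addr0, add0r).
  by case/eq_col_mx.
Qed.

(** For comparable [x] and [y] both composites equal [U x *m rmor X x y *m W y]; [interval_const]
    spreads the equality over [S]. This expresses that endomorphisms of V_J over [S] are scalars. *)
Lemma hom_pair_const S J X p (U : forall x, 'M[K]_(p, rdim X x))
    (W : forall x, 'M[K]_(rdim X x, p)) :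
  is_interval J -> ss_set J \subset S -> hom_pair S J U W ->
  forall x y, x \in S -> x \in J -> y \in S -> y \in J -> U x *m W x = U y *m W y.
Proof.
move=> iJ ssS UW; apply: (interval_const iJ ssS) => x y Sx Jx Sy Jy xy.
have [/(_ Jx) UX /(_ Jy) XW] := UW x y Sx Sy xy.
move: UX XW; rewrite Jx Jy !scale1r => UX XW.
by rewrite -UX -XW mulmxA.
Qed.

Lemma is_rep_Vrep S J : is_interval J -> is_rep S (Vrep K J).
Proof.
move=> iJ; split=> [x Sx|x y z Sx Sy Sz xy yz] /=.
  case: (x \in J); last by rewrite [LHS]flatmx0 [RHS]flatmx0.
  by apply/matrixP => i j; rewrite !mxE !ord1.
rewrite const_mx1_mul.
case Jx: (x \in J); last by rewrite [LHS]flatmx0 [RHS]flatmx0.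
case Jz: (z \in J); last by rewrite [LHS]thinmx0 [RHS]thinmx0.
by rewrite (interval_convex iJ Jx Jz xy yz) scale1r.
Qed.

Lemma mult_ge_Vrep S J : mult_ge S J (Vrep K J) 1.
Proof.
exists (fun x => const_mx 1), (fun x => const_mx 1).
split=> [x y Sx Sy xy|x Sx Jx] /=.
  rewrite !const_mx1_mul; split=> [Jx|Jy]; rewrite ?Jx ?Jy scale1r.
    by case: (y \in J); rewrite ?scale1r // scale0r [LHS]thinmx0.
  by case: (x \in J); rewrite ?scale1r // scale0r [LHS]flatmx0.
by rewrite const_mx1_mul Jx scale1r; apply/matrixP => i j; rewrite !mxE !ord1.
Qed.

Lemma mult_ge_npow S J k : mult_ge S J (npow (Vrep K J) k) k.
Proof.
elim: k => [|k IHk] /=; first exact: mult_ge0.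
by rewrite -add1n; apply: mult_ge_dsum (mult_ge_Vrep S J) IHk.
Qed.

Lemma mult_le_Vrep1 S J L : mult_le S J (Vrep K L) 1.
Proof.
move=> p U W _ x _ _; apply: leq_trans (mxrankM_maxl _ _) _.
by apply: leq_trans (rank_leq_col _) _ => /=; case: (x \in L).
Qed.

(** The bound is a boolean read as 0 or 1. At a vertex of [S] outside [L] the composite factors
    through a zero space, and being constant it vanishes everywhere. *)
Lemma mult_le_Vrep_sub S J L : is_interval J -> ss_set J \subset S -> S \subset J ->
  mult_le S J (Vrep K L) (S \subset L).
Proof.
move=> iJ ssS /subsetP SJ; have [_|] := boolP (S \subset L); first exact: mult_le_Vrep1.
case/subsetPn => y Sy Ly p U W UW x Sx Jx.
rewrite (hom_pair_const iJ ssS UW Sx Jx Sy (SJ y Sy)).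
apply: leq_trans (mxrankM_maxl _ _) _; apply: leq_trans (rank_leq_col _) _.
by rewrite /= (negPf Ly).
Qed.

(** A nonzero composite is nonzero at every vertex of [J], which forces [J] inside [L]. Since the
    maps of V_L inside [L] are invertible, no comparison in [L] can enter or leave [J], and
    connectedness of [L] gives equality. *)
Lemma mult_le_Vrep_eq J L : is_interval J -> is_interval L ->
  mult_le setT J (Vrep K L) (J == L).
Proof.
move=> iJ iL; have [_|JL] := eqVneq J L; first exact: mult_le_Vrep1.
move=> p U W UW x0 _ Jx0; rewrite leqn0; apply: contraNT JL => nz.
have UWnz x : x \in J -> U x *m W x != 0.
  move=> Jx; apply: contraNneq nz => UW0.
  by rewrite (hom_pair_const iJ (subsetT _) UW _ Jx0 _ Jx) ?inE // UW0 mxrank0.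
have JsubL x : x \in J -> x \in L.
  move=> Jx; apply: contraNT (UWnz x Jx) => Lx.
  by rewrite -mxrank_eq0 -leqn0; apply: leq_trans (mxrankM_maxl _ _) _;
    apply: leq_trans (rank_leq_col _) _; rewrite /= (negPf Lx).
have hc x y : x \in [set: vert m n] -> x \in L -> y \in [set: vert m n] -> y \in L ->
    vle x y -> (x \in J) = (y \in J).
  move=> Tx Lx Ty Ly xy; have [UX XW] := UW x y Tx Ty xy.
  have id_xy : (const_mx 1 : 'M[K]_((x \in L), (x \in L))) = 1%:M.
    exact: (is_rep_Vrep setT iL).1.
  (* Leaving [J] on the way up kills [U x]; entering [J] kills [W y]. *)
  apply/idP/idP => Jz; apply: contraTT (UWnz _ Jz) => nJ; rewrite negbK.
    move: (UX Jz); rewrite (negPf nJ) scale0r => /(congr1 (mulmx^~ (const_mx 1 : 'M_(_, (x \in L))))).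
    by rewrite mul0mx /= -mulmxA const_mx1_mul Ly scale1r id_xy mulmx1 => ->; rewrite mul0mx.
  move: (XW Jz); rewrite (negPf nJ) scale0r => /(congr1 (mulmx (const_mx 1 : 'M_((y \in L), _)))).
  rewrite mulmx0 /= mulmxA const_mx1_mul Lx scale1r.
  rewrite [const_mx 1](_ : _ = 1%:M) ?mul1mx => [->|]; first by rewrite mulmx0.
  exact: ((is_rep_Vrep setT iL).1 y).
apply/eqP/setP => x; apply/idP/idP => [/JsubL //|Lx].
have /= := @interval_const m n _ (fun x => x \in J) L setT iL (subsetT _) hc x0 x.
by rewrite Jx0 => <- //; rewrite ?inE ?JsubL.
Qed.

End Multiplicity.

(** * Multiplicities in sums of intervals, and splitting off interval summands *)

Section Decompositions.
Context {K : fieldType} {m n : nat}.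
Implicit Types (S I J L : {set vert m n}) (s t : seq {set vert m n}).
Implicit Types (X Y M : rawrep K m n) (x y : vert m n).

Lemma Vrep_iso S J L : S \subset J -> S \subset L -> rep_iso S (Vrep K L) (Vrep K J).
Proof.
move=> /subsetP SJ /subsetP SL.
exists (fun x => const_mx 1), (fun x => const_mx 1).
split=> [x y Sx Sy _|x y Sx Sy _|x Sx] /=; rewrite !const_mx1_mul ?SJ ?SL //.
by rewrite !scale1r; split; apply/matrixP => i j; rewrite !mxE !ord1.
Qed.

(** Over [S] each V_L with [S] inside [L] is the constant representation K, hence isomorphic to
    V_J. *)
Lemma bigdsum_Vrep_extract S J s : S \subset J ->
  rep_iso S (bigdsum s (@Vrep K m n))
    (dsum (npow (Vrep K J) (count (fun L : {set vert m n} => S \subset L) s))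
          (bigdsum [seq L : {set vert m n} <- s | ~~ (S \subset L)] (@Vrep K m n))).
Proof.
move=> SJ; pose p (L : {set vert m n}) := S \subset L.
have : perm_eq s ([seq L <- s | p L] ++ [seq L <- s | ~~ p L]).
  by rewrite perm_sym; apply/permPl/(perm_filterC p).
move/(bigdsum_perm_iso S (@Vrep K m n))/rep_iso_trans; apply; apply: rep_iso_trans (bigdsum_cat_iso _ _ _ _) _.
apply: rep_iso_dsum (rep_iso_refl _ _).
elim: s => [|L s IHs] /=; first exact: rep_iso_refl.
rewrite -/(p L); case: ifP => // pL /=.
by apply: rep_iso_dsum IHs; apply: Vrep_iso.
Qed.

Lemma is_rep_bigdsum_Vrep S s :
  all (fun L => L \in intervals m n) s -> is_rep S (bigdsum s (@Vrep K m n)).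
Proof.
elim: s => [_|L s IHs /= /andP[]] /=; first exact: is_rep_zrep.
by rewrite inE => iL /IHs; apply: is_rep_dsum; apply: is_rep_Vrep.
Qed.

Lemma mult_le_zrep S J : mult_le S J (zrep K m n) 0.
Proof.
by move=> p U W _ x _ _; apply: leq_trans (mxrankM_maxl _ _) (rank_leq_col _).
Qed.

Lemma mult_le_bigdsum S J (c : {set vert m n} -> bool) s :
  (forall L, L \in s -> mult_le S J (Vrep K L) (c L)) ->
  mult_le S J (bigdsum s (@Vrep K m n)) (count c s).
Proof.
elim: s => [_|L s IHs le_s] /=; first exact: mult_le_zrep.
apply: mult_le_dsum; first by apply: le_s; rewrite mem_head.
by apply: IHs => L' sL'; apply: le_s; rewrite inE sL' orbT.
Qed.

Lemma mult_ge_bigdsum J s :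
  mult_ge setT J (bigdsum s (@Vrep K m n)) (count_mem J s).
Proof.
elim: s => [|L s IHs] /=; first exact: mult_ge0.
apply: mult_ge_dsum IHs; case: eqVneq => [->|_]; [exact: mult_ge_Vrep|exact: mult_ge0].
Qed.

(** The rank bound on each summand gives one inequality; the copies of V_J extracted explicitly,
    together with the maximality of [d], give the other. *)
Lemma is_mult_count e J M s d :
  J \in intervals m n -> all (fun L => L \in intervals m n) s ->
  rep_iso setT M (bigdsum s (@Vrep K m n)) ->
  is_mult (essv e J) (Vrep K J) M d -> d = count (fun L : {set vert m n} => J \subset L) s.
Proof.
rewrite inE => iJ int_s isoM [[Y [_ isoY]] max_d].
have {}isoM : rep_iso (essv e J) M (bigdsum s (@Vrep K m n)).
  exact: rep_iso_sub (subsetT _) isoM.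
have -> : count (fun L : {set vert m n} => J \subset L) s = count (fun L : {set vert m n} => essv e J \subset L) s.
  apply: eq_in_count => L /(allP int_s); rewrite inE => iL.
  by rewrite essv_sub_interval.
have [x0 Jx0] := interval_neq0 iJ; have [x ss_x _] := source_below Jx0.
have Jx : x \in J by apply: (subsetP (ss_set_sub J)).
have Sx : x \in essv e J by apply: (subsetP (ss_set_essv e J)).
apply/eqP; rewrite eqn_leq; apply/andP; split.
  apply: (mult_ge_le Sx Jx) (mult_le_bigdsum _).
    apply: mult_ge_iso isoM _; apply: mult_ge_iso (rep_iso_sym isoY) _.
    by rewrite -[X in mult_ge _ _ _ X]addn0; apply: mult_ge_dsum (mult_ge_npow _ _ _) (mult_ge0 _ _ _).
  by move=> L _; apply: mult_le_Vrep_sub; rewrite ?ss_set_essv ?essv_sub.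
apply: max_d; last exact: rep_iso_trans isoM (bigdsum_Vrep_extract _ (essv_sub e J)).
by apply: is_rep_bigdsum_Vrep; apply/allP => L; rewrite mem_filter => /andP[_ /(allP int_s)].
Qed.

(** Multiplying by [const_mx 1] gives [U] and [W] the dimensions of V_J and erases their
    unconstrained components outside [J]. *)
Lemma mult_ge1_split S J X : is_rep S X -> mult_ge S J X 1 ->
  exists2 Y, is_rep S Y & rep_iso S X (dsum (Vrep K J) Y).
Proof.
move=> repX [U [W [UW UW1]]].
apply: (@rep_split K m n S X (Vrep K J) (fun x => const_mx 1 *m U x)
         (fun x => W x *m const_mx 1)) => // [x y Sx Sy xy|x y Sx Sy xy|x Sx] /=.
- have [UX _] := UW x y Sx Sy xy; rewrite mulmxA const_mx1_mul -scalemxAl -mulmxA.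
  case: (x \in J) UX => [->//|_]; first by rewrite -scalemxAr.
  by rewrite [LHS]flatmx0 [RHS]flatmx0.
- have [_ XW] := UW x y Sx Sy xy; rewrite -[RHS]mulmxA const_mx1_mul -scalemxAr mulmxA.
  case: (y \in J) XW => [->//|_]; first by rewrite -scalemxAl.
  by rewrite [LHS]thinmx0 [RHS]thinmx0.
- rewrite mulmxA -(mulmxA _ (U x)).
  case Jx: (x \in J); last by rewrite [LHS]flatmx0 [RHS]flatmx0.
  rewrite UW1 // mulmx1 const_mx1_mul scale1r.
  by apply/matrixP => i j; rewrite !mxE !ord1.
Qed.

(** A nonzero entry of a composite selects one coordinate on each side. The composite is constant on
    [J], so a single scalar [c^-1] normalizes it to 1 at all vertices. *)
Lemma mult_le0 S J X : is_interval J -> ss_set J \subset S ->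
  ~ mult_ge S J X 1 -> mult_le S J X 0.
Proof.
move=> iJ ssS no1 p U W UW x Sx Jx; rewrite leqn0 mxrank_eq0; apply/eqP.
apply: NNPP => /eqP/matrix0Pn[i [j nz]]; apply: no1.
pose c := (U x *m W x) i j.
exists (fun z => delta_mx 0 i *m U z), (fun z => c^-1 *: (W z *m delta_mx j 0)).
split=> [y z Sy Sz yz|z Sz Jz].
  have [UX XW] := UW y z Sy Sz yz; split=> [Jy|Jz].
    by rewrite -mulmxA UX // scalemxAr.
  by rewrite -scalemxAr mulmxA XW // -scalemxAl !scalerA mulrC.
rewrite -scalemxAr mulmxA -(mulmxA _ (U z)) (hom_pair_const iJ ssS UW Sz Jz Sx Jx).
rewrite -rowE -colE; move: (U x *m W x) @c nz => C c nz.
by apply/matrixP => a b; rewrite !mxE !ord1 mulVf.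
Qed.

(** Interval summands are split off as long as one exists. The total dimension drops each time
    because intervals are nonempty. *)
Lemma interval_part X : is_rep setT X ->
  exists t Y, [/\ all (fun L => L \in intervals m n) t,
    rep_iso setT X (dsum (bigdsum t (@Vrep K m n)) Y) &
    forall J, is_interval J -> mult_le setT J Y 0].
Proof.
have [k] := ubnP (\sum_x rdim X x)%N; elim: k X => // k IHk X ltX repX.
have [[J [iJ geJ]]|no1] := classic (exists J, is_interval J /\ mult_ge setT J X 1).
  have [Y repY isoX] := mult_ge1_split repX geJ.
  have [|//|t [Z [int_t isoY noZ]]] := IHk Y _; last first.
    exists (J :: t), Z; split=> //=; first by rewrite inE iJ.
    apply: rep_iso_trans isoX (rep_iso_trans _ (rep_iso_sym (dsumA_iso _ _ _ _))).
    exact: rep_iso_dsum (rep_iso_refl _ _) isoY.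
  have [x0 Jx0] := interval_neq0 iJ.
  rewrite -ltnS; apply: leq_trans _ ltX; rewrite ltnS.
  under [leqRHS]eq_bigr => x _ do rewrite (rep_iso_rdim isoX (in_setT x)).
  by rewrite big_split /= -[ltnLHS]add0n ltn_add2r (bigD1 x0) //= Jx0.
exists [::], X; split=> //; last first.
  by move=> J iJ; apply: mult_le0 (subsetT _) _ => // geJ; apply: no1; exists J.
by apply: rep_iso_sym; apply: rep_iso_trans (dsumC_iso _ _ _) _; apply: dsum0_iso.
Qed.

Lemma mult_le_intervals J s : is_interval J -> all (fun L => L \in intervals m n) s ->
  mult_le setT J (bigdsum s (@Vrep K m n)) (count_mem J s).
Proof.
move=> iJ int_s; rewrite (eq_count (a2 := fun L : {set vert m n} => J == L)); last by move=> L /=; rewrite eq_sym.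
by apply: mult_le_bigdsum => L /(allP int_s); rewrite inE; apply: mult_le_Vrep_eq.
Qed.

(* Cancellation without Krull-Schmidt: the multiplicity of each V_J is additive,
   and a dimension count leaves no room for the non-interval part of M. *)
Lemma int_dec_cancel M Z p q :
  is_rep setT M -> is_rep setT Z ->
  all (fun L => L \in intervals m n) p -> all (fun L => L \in intervals m n) q ->
  rep_iso setT (dsum (bigdsum p (@Vrep K m n)) Z)
               (dsum (dsum M (bigdsum q (@Vrep K m n))) Z) ->
  int_dec M.
Proof.
move=> repM repZ int_p int_q isoPMQ.
have [t [M' [int_t isoM noM']]] := interval_part repM.
have [r [Z' [int_r isoZ noZ']]] := interval_part repZ.
have part_ge X s Y J : rep_iso setT X (dsum (bigdsum s (@Vrep K m n)) Y) ->
    mult_ge setT J X (count_mem J s).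
  move=> isoX; apply: mult_ge_iso (rep_iso_sym isoX) _; rewrite -[count_mem J s]addn0.
  exact: mult_ge_dsum (mult_ge_bigdsum _ _) (mult_ge0 _ _ _).
have part_le X s Y J : is_interval J -> all (fun L => L \in intervals m n) s ->
    (forall J, is_interval J -> mult_le setT J Y 0) ->
    rep_iso setT X (dsum (bigdsum s (@Vrep K m n)) Y) -> mult_le setT J X (count_mem J s).
  move=> iJ int_s noY isoX; apply: mult_le_iso (rep_iso_sym isoX) _.
  by rewrite -[count_mem J s]addn0; apply: mult_le_dsum (mult_le_intervals _ _) (noY _ _).
(* Both sides of [isoPMQ] have sharp bounds on the multiplicity of V_J, with a common term coming
   from [r] that cancels. *)
have eq_count J : is_interval J -> count_mem J p = count_mem J (t ++ q).
  move=> iJ; have [x0 Jx0] := interval_neq0 iJ.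
  apply/eqP; rewrite -(eqn_add2r (count_mem J r)) count_cat eqn_leq; apply/andP; split.
    apply: (mult_ge_le (in_setT x0) Jx0).
      apply: mult_ge_iso isoPMQ _; apply: mult_ge_dsum (mult_ge_bigdsum _ _) _.
      exact: part_ge isoZ.
    apply: mult_le_dsum (mult_le_dsum _ (mult_le_intervals _ _)) _ => //.
      exact: part_le isoM.
    exact: part_le isoZ.
  apply: (mult_ge_le (in_setT x0) Jx0).
    apply: mult_ge_iso (rep_iso_sym isoPMQ) _.
    apply: mult_ge_dsum (mult_ge_dsum _ (mult_ge_bigdsum _ _)) _.
      exact: part_ge isoM.
    exact: part_ge isoZ.
  apply: mult_le_dsum (mult_le_intervals _ _) _ => //; exact: part_le isoZ.
have perm_p : perm_eq p (t ++ q).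
  apply/allP => J; rewrite mem_cat mem_cat => memJ /=; rewrite eq_count //.
  by case/or3P: memJ => [/(allP int_p)|/(allP int_t)|/(allP int_q)]; rewrite inE.
exists t; split=> //; apply: (rep_iso_trans isoM); apply: dsum0_iso => x Tx.
(* With [p] a rearrangement of [t ++ q], comparing dimensions leaves 0 for [M'] at every vertex. *)
have := rep_iso_rdim isoPMQ Tx; have := rep_iso_rdim isoM Tx.
rewrite /= !rdim_bigdsum (perm_big _ perm_p) /= big_cat /=.
by lia.
Qed.

End Decompositions.

(** * Moebius inversion on the poset of intervals *)

Section Moebius.
Context {m n : nat}.
Implicit Types (I J L : {set vert m n}) (s : seq {set vert m n}).

(** Recursive calls go to proper subsets, so any fuel above the cardinality gives the same value. *)
Lemma mobf_fuel f f' I J : (#|J| < f)%N -> (#|J| < f')%N -> mobf f I J = mobf f' I J.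
Proof.
elim: f f' J => [|f IHf] [|f'] J //; rewrite !ltnS => Jf Jf' /=.
case: ifP => // _; case: ifP => // _; congr (- _); apply: eq_bigr => L /and3P[_ _ /proper_card LJ].
by apply: IHf; apply: leq_trans LJ _.
Qed.

Lemma sum_mobius I L : I \in intervals m n -> L \in intervals m n -> I \subset L ->
  \sum_(J in intervals m n | (I \subset J) && (J \subset L)) mobius I J = (I == L)%:Z.
Proof.
move=> iI iL IL.
rewrite (bigD1 L) /=; last by rewrite iL IL subxx.
have [eIL|neq] := eqVneq I L.
  rewrite {1}/mobius /= eIL eqxx big1 ?addr0 // => J /andP[/and3P[_ LJ JL]].
  by rewrite eqEsubset LJ JL.
have pIL : I \proper L by rewrite properEneq neq IL.
(* The term at [L] unfolds to minus the sum over smaller intervals, taken with fuel [#|L|] instead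
   of the fuel in [mobius]. *)
rewrite {1}/mobius /= (negPf neq) pIL addrC; apply/eqP; rewrite subr_eq0; apply/eqP.
apply: eq_big => [J|J]; first by rewrite properEneq -!andbA andbC -!andbA; do !bool_congr.
case/andP=> /and3P[_ _ JL] neqJL; apply: mobf_fuel; rewrite ?ltnS //.
by apply: proper_card; rewrite properEneq neqJL.
Qed.

(** After exchanging the sums, a summand [L] of [s] contributes the Moebius values summed over the
    intervals between [I] and [L], that is 1 if [L] is [I] and 0 otherwise. *)
Lemma dtilde_count (dbar : {set vert m n} -> nat) s I :
  all (fun L => L \in intervals m n) s ->
  (forall J, J \in intervals m n -> dbar J = count (fun L : {set vert m n} => J \subset L) s) ->
  I \in intervals m n -> dtilde dbar I = (count_mem I s)%:Z.
Proof.
move=> int_s dbarE iI; rewrite /dtilde.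
under eq_bigr => J /andP[iJ _] do
  rewrite dbarE // -sum1_count -natz natr_sum mulr_sumr big_mkcond /=.
rewrite exchange_big /= -sum1_count -natz natr_sum [RHS]big_mkcond /=.
rewrite !big_seq; apply: eq_bigr => L /(allP int_s) iL.
rewrite -big_mkcondr /=; under eq_bigr => J _ do rewrite mulr1.
have [IL|nIL] := boolP (I \subset L).
  under eq_bigl => J do rewrite -andbA.
  by rewrite sum_mobius // eq_sym; case: eqP.
rewrite big1 => [|J /andP[/andP[_ IJ] JL]]; last by case/negP: nIL; apply: subset_trans JL.
by case: eqVneq nIL => // ->; rewrite subxx.
Qed.

End Moebius.

(** * Assembly of the two directions *)

Lemma perm_flatten_nseq (T : eqType) (r s : seq T) (c : T -> nat) :
  uniq r -> {subset s <= r} -> {in r, forall a, c a = count_mem a s} ->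
  perm_eq (flatten [seq nseq (c a) a | a <- r]) s.
Proof.
move=> uniq_r sub_s cE; apply/allP => x _; apply/eqP.
rewrite count_flatten -map_comp sumnE big_map.
under eq_bigr => a _ do rewrite /= count_nseq.
have [rx|nrx] := boolP (x \in r).
  rewrite (bigD1_seq x) //= eqxx mul1n cE // big1 ?addn0 // => a ne.
  by rewrite /= (negPf ne).
rewrite big_seq big1 => [|a ra]; last by rewrite /=; case: eqP ra nrx => // -> ->.
by apply/esym/count_memPn; apply: contra nrx; apply: sub_s.
Qed.

Theorem mainTheorem14 (K : fieldType) (m n : nat) (e : ess)
  (M : rawrep K m n) (dbar : {set vert m n} -> nat) :
  (0 < m)%N -> (0 < n)%N ->
  is_rep setT M ->
  (forall I, I \in intervals m n ->
     is_mult (essv e I) (Vrep K I) M (dbar I)) ->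
  (int_dec M ->
     [/\ gr_eq (Mplus K dbar) (Mminus K dbar) M,
         rep_iso setT (Mplus K dbar) M &
         forall I, I \in intervals m n -> 0 <= dtilde dbar I]) /\
  (gr_eq (Mplus K dbar) (Mminus K dbar) M -> int_dec M).
Proof.
move=> _ _ repM multM; split=> [[s [int_s isoM]]|[Z [repZ isoZ]]].
  have dtE I : I \in intervals m n -> dtilde dbar I = (count_mem I s)%:Z.
    apply: dtilde_count => // J iJ; exact: is_mult_count iJ int_s isoM (multM J iJ).
  have isoP : rep_iso setT (Mplus K dbar) M.
    apply: rep_iso_trans (rep_iso_sym isoM); apply: rep_iso_trans (bigdsum_npow_iso _ _ _ _) _.
    apply: bigdsum_perm_iso; apply: perm_flatten_nseq; first exact: enum_uniq.
      by move=> L /(allP int_s); rewrite mem_enum.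
    by move=> I; rewrite mem_enum /posn => /dtE->; case: (count_mem I s).
  (* The zero representation serves as stabilizer, because [Mplus] is already isomorphic to [M] and
     [Mminus] has dimension 0 at every vertex. *)
  split=> // [|I /dtE-> //]; exists (zrep K m n); split; first exact: is_rep_zrep.
  have dsumz A : rep_iso setT (dsum A (zrep K m n)) A by apply: dsum0_iso.
  apply: rep_iso_trans (dsumz _) (rep_iso_trans _ (rep_iso_sym (dsumz _))).
  apply: rep_iso_trans isoP (rep_iso_sym _); apply: dsum0_iso => x _.
  rewrite rdim_bigdsum big_seq big1 // => I; rewrite mem_enum => /dtE dtI.
  by rewrite rdim_npow /posn dtI; case: (count_mem I s).
have intE (c : {set vert m n} -> nat) :
    all (fun L => L \in intervals m n) (flatten [seq nseq (c a) a | a <- enum (intervals m n)]).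
  by apply/allP => L /flatten_mapP[a]; rewrite mem_enum mem_nseq => ia /andP[_ /eqP->].
(* The powers in [Mplus] and [Mminus] are flattened to lists of intervals to fit the cancellation
   lemma. *)
apply: int_dec_cancel repM repZ (intE _) (intE _) _.
apply: rep_iso_trans (rep_iso_dsum (rep_iso_sym (bigdsum_npow_iso _ _ _ _)) (rep_iso_refl _ _)) _.
apply: rep_iso_trans isoZ _; apply: rep_iso_dsum (rep_iso_refl _ _).
exact: rep_iso_dsum (rep_iso_refl _ _) (bigdsum_npow_iso _ _ _ _).
Qed.
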